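(* For all $\epsilon>0$, there exist a finite set $S$ of integers and a real number $K>1$ with $|S+S|\le K|S|$ but with $|S+2\cdot S|>K^{2-\epsilon}|S|$.
   Context: For $S\subset\mathbb{Z}$ and an integer $k$, $S+k\cdot S=\{a+kb:a,b\in S\}$; $S+S$ is the case $k=1$. *)

(* Defs.v *)
From HB Require Import structures.
From mathcomp Require Import all_boot all_order all_algebra.
From mathcomp Require Import finmap.
From mathcomp Require Import reals exp.

Set Implicit Arguments.
Unset Strict Implicit.
Unset Printing Implicit Defensive.

Import Order.TTheory GRing.Theory Num.Theory.

Local Open Scope fset_scope.
Local Open Scope ring_scope.

(* S + k . S = {a + k b : a, b in S}, where k . S is the dilate of S by k. *)
Definition sum_dilate (S : {fset int}) (k : int) : {fset int} :=
  [fset a + k * b | a in S, b in S].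

(* Main.v *)
Require Import Defs.
From HB Require Import structures.
From mathcomp Require Import all_boot all_order all_algebra.
From mathcomp Require Import finmap.
From mathcomp Require Import reals exp.
From mathcomp Require Import zify lra.

(** The set [S] is the union of a large box [A] with small sumset and a
    negligible set [B] on which the two sums behave very differently.

    Write integers in base [2N] and let [A] be the set of numbers with [d]
    digits, all less than [N]: a [d]-dimensional box of size [N^d], with
    [A + A] of size about [2^d N^d].  Let [B] be the set of numbers
    [b + (2N)^d c], where [b] has [d] digits in [{0, 1}] and [c < 2^d]: it
    consists of [2^d] far apart copies of the discrete cube [{0,1}^d].

    - Adding a cube to the box enlarges its sides only from [N] to [N + 1], so
      [A + B] has at most [2^d (N+1)^d] elements, again about [2^d N^d];
      [B + B] is negligible once [N] is large compared with [d].  Therefore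
      [S + S] has at most [K N^d] elements with [K = 2^(d+2)].
    - In [B + 2 . A], on the contrary, the cube represents every class modulo 2
      in every digit, so that each of the [2^d] copies of the cube produces a
      full box of side [2N]: every digit [x < 2N] is [b + 2 a] with [b < 2] and
      [a < N].  Therefore [S + 2 . S] has at least [2^d (2N)^d = 4^d N^d]
      elements.

    Since [4^d] is [K^2] up to a constant factor and [K] is unbounded as [d]
    grows, [4^d] exceeds every [K^(2-eps)] by an arbitrary factor
    ([dilate_gap]). *)

Set Implicit Arguments.
Unset Strict Implicit.
Unset Printing Implicit Defensive.

Import Order.TTheory GRing.Theory Num.Theory.

Local Open Scope fset_scope.
Local Open Scope ring_scope.

Section Boxes.
Local Open Scope nat_scope.

Fixpoint box (L m d : nat) : seq nat :=
  if d is d'.+1 then [seq a + L * x | a <- iota 0 m, x <- box L m d']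
  else [:: 0].

Lemma boxSP L m d x :
  reflect (exists a y, [/\ a < m, y \in box L m d & x = a + L * y])
          (x \in box L m d.+1).
Proof.
apply: (iffP allpairsP) => [[[a y] /= [am yB ->]]|[a [y [am yB ->]]]].
  by exists a, y; split=> //; rewrite mem_iota in am.
by exists (a, y); split=> //=; rewrite mem_iota.
Qed.

Lemma size_box L m d : size (box L m d) = m ^ d.
Proof. by elim: d => //= d IHd; rewrite size_allpairs size_iota IHd expnS. Qed.

Lemma box_uniq L m d : m <= L -> uniq (box L m d).
Proof.
move=> mL; elim: d => //= d IHd; apply: allpairs_uniq => //; first exact: iota_uniq.
move=> _ _ /allpairsP[[a x] /= [am _ ->]] /allpairsP[[b y] /= [bm _ ->]] /= E.
rewrite !mem_iota /= in am bm.
have eqx : x = y by nia.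
by congr pair; first nia.
Qed.

Lemma box_add L m n d x y : x \in box L m.+1 d -> y \in box L n.+1 d ->
  x + y \in box L (m + n).+1 d.
Proof.
elim: d x y => [|d IHd] x y; first by rewrite !inE => /eqP-> /eqP->.
move=> /boxSP[a [x' [am x'B ->]]] /boxSP[b [y' [bm y'B ->]]].
by apply/boxSP; exists (a + b), (x' + y'); split; [lia|exact: IHd|lia].
Qed.

(** The parities of the digits form a point of the cube: this is where adding
    the dilate by 2 gains over adding the box itself. *)
Lemma box_halve L n d x : x \in box L n.*2 d ->
  exists b a, [/\ b \in box L 2 d, a \in box L n d & x = b + 2 * a].
Proof.
elim: d x => [|d IHd] x; first by rewrite inE => /eqP->; exists 0, 0.
move=> /boxSP[a [y [an /IHd[b' [a' [b'B a'B ->]]] ->]]].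
exists (odd a + L * b'), (a./2 + L * a'); split.
- by apply/boxSP; exists (odd a), b'; split=> //; case: (odd a).
- by apply/boxSP; exists a./2, a'; split=> //; lia.
- by have := odd_double_half a; lia.
Qed.

Lemma box_lt L m d x : m <= L -> x \in box L m d -> x < L ^ d.
Proof.
move=> mL; elim: d x => [|d IHd] x; first by rewrite inE => /eqP->.
by move=> /boxSP[a [y [am /IHd yB ->]]]; rewrite expnS; nia.
Qed.

(** Translates of a box in a further direction; the step [L ^ d] is beyond the
    box, so that different translates are disjoint. *)
Definition stack (L m d r : nat) : seq nat :=
  [seq x + L ^ d * c | x <- box L m d, c <- iota 0 r].

Lemma stackP L m d r x :
  reflect (exists y c, [/\ y \in box L m d, c < r & x = y + L ^ d * c])
          (x \in stack L m d r).
Proof.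
apply: (iffP allpairsP) => [[[y c] /= [yB cr ->]]|[y [c [yB cr ->]]]].
  by exists y, c; split=> //; rewrite mem_iota in cr.
by exists (y, c); split=> //=; rewrite mem_iota.
Qed.

Lemma size_stack L m d r : size (stack L m d r) = m ^ d * r.
Proof. by rewrite size_allpairs size_box size_iota. Qed.

Lemma stack_uniq L m d r : m <= L -> uniq (stack L m d r).
Proof.
move=> mL; apply: allpairs_uniq; [exact: box_uniq|exact: iota_uniq|].
move=> _ _ /allpairsP[[x b] /= [xB _ ->]] /allpairsP[[y c] /= [yB _ ->]] /= E.
have xL := box_lt mL xB; have yL := box_lt mL yB.
have eqb : b = c by nia.
by congr pair; first nia.
Qed.

(** Bernoulli's inequality for [(1 - 1/(n+1))^d]: increasing a large side by
    one at most doubles the volume of the box. *)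
Lemma expn_succ_le d n : d.*2 <= n -> n.+1 ^ d <= 2 * n ^ d.
Proof.
move=> dn; have H k : k <= n.+1 -> n.+1 ^ k * (n.+1 - k) <= n.+1 * n ^ k.
  elim: k => [|k IHk] kn; first by rewrite !expn0; lia.
  have {}IHk := IHk (ltnW kn); rewrite !expnS; nia.
have {}H := H d; nia.
Qed.

End Boxes.

Lemma card_fset_le (X : {fset int}) (s : seq nat) :
  (forall z, z \in X -> exists2 x, x \in s & z = Posz x) ->
  (#|` X| <= size s)%N.
Proof.
move=> H; rewrite -(size_map Posz); apply: uniq_leq_size; first exact: fset_uniq.
by move=> z /H[x xs ->]; rewrite map_f.
Qed.

Lemma card_fset_ge (X : {fset int}) (s : seq nat) :
  uniq s -> (forall x, x \in s -> Posz x \in X) -> (size s <= #|` X|)%N.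
Proof.
move=> Us H; rewrite -(size_map Posz).
apply: uniq_leq_size; first by rewrite map_inj_uniq // => x y [].
by move=> _ /mapP[x xs ->]; apply: H.
Qed.

Definition fset_of_nats (s : seq nat) : {fset int} := [fset Posz x | x in s].

Lemma fset_of_natsP (s : seq nat) (z : int) :
  reflect (exists2 x, x \in s & z = Posz x) (z \in fset_of_nats s).
Proof. exact: imfsetP. Qed.

Lemma sum_dilate_natsP (s : seq nat) (k : nat) (z : int) :
  reflect (exists x y, [/\ x \in s, y \in s & z = Posz (x + k * y)])
          (z \in sum_dilate (fset_of_nats s) k).
Proof.
apply: (iffP (imfset2P _ _ _ _ _)).
  move=> [_ /fset_of_natsP[x xs ->] [_ /fset_of_natsP[y ys ->] ->]].
  by exists x, y; split=> //; lia.
move=> [x [y [xs ys ->]]]; exists (Posz x); first by apply/fset_of_natsP; exists x.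
by exists (Posz y); [apply/fset_of_natsP; exists y|lia].
Qed.

(** The set of the construction, with the sizes measured in terms of the volume
    [V] of the box. *)
Lemma dilate_box_cubes (d : nat) : (0 < d)%N ->
  exists (S : {fset int}) (V : nat),
    [/\ (0 < V)%N, (V <= #|` S|)%N, (#|` S| <= 2 * V)%N,
        (#|` sum_dilate S 1| <= 2 ^ d.+2 * V)%N
      & (4 ^ d * V <= #|` sum_dilate S 2|)%N].
Proof.
move=> d0.
(* The side N = n + 1 exceeds 2d, as Bernoulli's inequality asks, and is at least
   6, which makes B and B + B negligible. *)
pose n := (d.*2 + 5)%N; pose L := n.+1.*2; pose M := (2 ^ d)%N.
pose A := box L n.+1 d; pose B := stack L 2 d M.
have lt_nL : (n < L)%N by rewrite /L; lia.
have sixd : (2 * 3 ^ d <= n.+1 ^ d)%N.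
  have le6 : (6 ^ d <= n.+1 ^ d)%N by rewrite leq_exp2r // /n; lia.
  apply: leq_trans le6; rewrite (expnMn 2 3) leq_mul2r.
  by rewrite (@leq_exp2l 2 1 d) // d0 orbT.
have fourd : (2 ^ d * M <= n.+1 ^ d)%N.
  by rewrite -expnMn leq_exp2r // /n; lia.
have succd : (n.+2 ^ d <= 2 * n.+1 ^ d)%N by apply: expn_succ_le; rewrite /n; lia.
exists (fset_of_nats (A ++ B)), (n.+1 ^ d)%N; split.
- by rewrite expn_gt0.
- rewrite -(size_box L); apply: card_fset_ge; first exact: box_uniq.
  by move=> x xA; apply/fset_of_natsP; exists x; rewrite // mem_cat xA.
- have /leq_trans : (#|` fset_of_nats (A ++ B)| <= size (A ++ B))%N.
    by apply: card_fset_le => z /fset_of_natsP.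
  by apply; rewrite size_cat size_box size_stack; lia.
- pose T := box L (n + n).+1 d ++ stack L (n + 1).+1 d M ++ stack L 3 d (M + M).
  have /leq_trans : (#|` sum_dilate (fset_of_nats (A ++ B)) 1| <= size T)%N.
    have AB x y : x \in A -> y \in B -> (x + y)%N \in stack L (n + 1).+1 d M.
      move=> xA /stackP[y' [c [y'B cM ->]]]; apply/stackP; exists (x + y')%N, c.
      by split=> //; [exact: box_add|lia].
    apply: card_fset_le => _ /(sum_dilate_natsP _ 1)[x [y [xS yS ->]]].
    exists (x + 1 * y)%N => //; rewrite mul1n !mem_cat.
    move: xS yS; rewrite !mem_cat => /orP[xA|xB] /orP[yA|yB].
    + by rewrite box_add.
    + by rewrite AB // orbT.
    + by rewrite addnC AB // orbT.
    + move: xB yB => /stackP[x' [b [x'B bM ->]]] /stackP[y' [c [y'B cM ->]]].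
      apply/orP; right; apply/orP; right.
      apply/stackP; exists (x' + y')%N, (b + c)%N; split; last by lia.
      * exact: (box_add (m := 1) (n := 1)).
      * by lia.
  apply; rewrite !size_cat size_box !size_stack.
  have AA : ((n + n).+1 ^ d <= M * n.+1 ^ d)%N.
    by rewrite -expnMn leq_exp2r //; lia.
  rewrite addn1 !expnS -/M; nia.
- have -> : (4 ^ d * n.+1 ^ d)%N = size (stack L n.+1.*2 d M).
    by rewrite size_stack -muln2 expnMn (expnMn 2 2) /M; lia.
  apply: card_fset_ge; first exact: stack_uniq.
  move=> _ /stackP[y [c [/box_halve[b [a [bB aB ->]]] cM ->]]].
  apply/(sum_dilate_natsP _ 2); exists (b + L ^ d * c)%N, a; split.
  + by rewrite mem_cat; apply/orP; right; apply/stackP; exists b, c.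
  + by rewrite mem_cat aB.
  + by lia.
Qed.

(** With [K = 2^(d+2)] one has [4^d = K^2 / 16], so it is enough that [K^eps]
    be at least 64: the remaining factor 4 absorbs the factor 2 in the bound on the
    size of [S]. *)
Lemma dilate_gap (R : realType) (eps : R) (d : nat) :
  6 <= eps * d.+2%:R ->
  4 * ((2 ^+ d.+2) `^ (2 - eps)) <= 4 ^+ d :> R.
Proof.
move=> large; set K : R := 2 ^+ d.+2.
have K0 : 0 < K by rewrite exprn_gt0.
have Keps : 64 <= K `^ eps.
  rewrite /K -powR_mulrn // -powRrM mulrC.
  have -> : 64 = 2 `^ 6%:R :> R by rewrite powR_mulrn //; lra.
  by apply: ler_powR => //; lra.
have EK : K `^ (2 - eps) * K `^ eps = 16 * 4 ^+ d.
  rewrite -powRD ?subrK ?gt_eqF ?implybT // powR_mulrn ?ltW // /K !exprS.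
  have -> : 4 ^+ d = (2 ^+ d) ^+ 2 :> R.
    by rewrite exprAC; congr (_ ^+ _); lra.
  by rewrite expr2; lra.
have := powR_ge0 K (2 - eps); nra.
Qed.

Theorem corollary12 (R : realType) (eps : R) (eps_gt0 : 0 < eps) :
  exists (S : {fset int}) (K : R),
    [/\ 1 < K,
        (#|` sum_dilate S 1|)%:R <= K * (#|` S|)%:R
      & (#|` sum_dilate S 2|)%:R > (K `^ (2 - eps)) * (#|` S|)%:R].
Proof.
have [d d0 large] : exists2 d : nat, (0 < d)%N & 6 <= eps * d.+2%:R.
  exists (Num.bound (6 / eps)).+1 => //.
  have : 6 / eps < (Num.bound (6 / eps))%:R.
    by apply: archi_boundP; rewrite divr_ge0 // ltW.
  rewrite ltr_pdivrMr // mulrC => /ltW/le_trans; apply.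
  by rewrite ler_pM2l // ler_nat; lia.
have [S [V [V0 VS SV S1 S2]]] := dilate_box_cubes d0.
exists S, (2 ^+ d.+2); split.
- by rewrite exprn_egt1 // ltr1n.
- have : (#|` sum_dilate S 1| <= 2 ^ d.+2 * #|` S|)%N.
    by apply: leq_trans S1 _; rewrite leq_mul2l VS orbT.
  by rewrite -(ler_nat R) natrM natrX.
- have gap := dilate_gap large.
  move: V0 SV S2; rewrite -(ltr_nat R) -!(ler_nat R) !natrM natrX => V0 SV S2.
  apply: lt_le_trans S2; have := powR_ge0 (2 ^+ d.+2) (2 - eps).
  have : 0 < 4 ^+ d :> R by rewrite exprn_gt0.
  nra.
Qed.
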